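(* Let $k$ be a field, $n$ a positive integer, $d$ an integer relatively prime to $n$, and let $k(t,s,x_0,x_1,\ldots,x_{n-1})$ be a field, generated over $k$ by elements $t,s,x_0,\ldots,x_{n-1}$, satisfying $\operatorname{trdeg}_k k(t,s,x_0,x_1,\ldots,x_{n-1})=n+1$ and $t^d=\prod_{i=0}^{n-1}x_i$. Let $G$ be a subgroup of $S_n$ (viewed as the group of permutations of $\{0,1,\ldots,n-1\}$) and let $\chi:G\to k^\times$ be a linear character with $\chi^d=1$ (the trivial character is allowed). Suppose that $G$ acts on $k(t,s,x_0,x_1,\ldots,x_{n-1})$ by $k$-automorphisms defined by $\sigma\cdot t:=\chi(\sigma)t$, $\sigma\cdot s:=s$, $\sigma\cdot x_i:=x_{\sigma\cdot i}$ for any $\sigma\in G$ and $0\le i\le n-1$. Then there exists an element $u\in k(t,s,x_0,x_1,\ldots,x_{n-1})$ such that $\sigma\cdot u=u$ for any $\sigma\in G$, and $$k(t,s,x_0,x_1,\ldots,x_{n-1})^G=k(x_0/s,x_1/s,\ldots,x_{n-1}/s)^G(u).$$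
   Context: For a group $G$ acting on a field $L$ by automorphisms, $L^G$ denotes the fixed subfield $\{f\in L:\sigma\cdot f=f\text{ for all }\sigma\in G\}$. A linear character $\chi:G\to k^\times$ is a group homomorphism; $\chi^d$ denotes the homomorphism $\sigma\mapsto\chi(\sigma)^d$, and $\chi^d=1$ means it is trivial. The subfield $k(x_0/s,\ldots,x_{n-1}/s)$ is stable under $G$, and $G$ acts on it by restriction. *)

(* Defs.v *)
From mathcomp Require Import all_boot all_order all_algebra all_fingroup.
From mathcomp Require Import classical_sets.
From mathcomp Require Import mpoly.

Set Implicit Arguments.
Unset Strict Implicit.
Unset Printing Implicit Defensive.

Import GRing.Theory.

Local Open Scope classical_set_scope.
Local Open Scope ring_scope.

Definition is_subfield (L : fieldType) (K : set L) : Prop :=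
  GRing.divring_closed (mem K).

(* The subfield of L generated by S; for a subfield K and u : L, the field K(u)
   is [gen_subfield (K `|` [set u])]. *)
Definition gen_subfield (L : fieldType) (S : set L) : set L :=
  smallest (@is_subfield L) S.

(* k(S), for S a subset of an extension iota : k -> L which, unlike a
   fieldExtType, need not be finite. *)
Definition gen_ext (k L : fieldType) (iota : {rmorphism k -> L}) (S : set L) :
    set L :=
  gen_subfield (range iota `|` S).

Definition alg_independent (k L : fieldType) (iota : {rmorphism k -> L})
    (m : nat) (b : 'I_m -> L) : Prop :=
  forall p : {mpoly k[m]}, mmap iota b p = 0 -> p = 0.

Definition algebraic_over (L : fieldType) (K : set L) (y : L) : Prop :=
  exists p : {poly L}, [/\ p != 0, p \is a polyOver (mem K) & root p y].

Definition is_transcendence_basis (k L : fieldType)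
    (iota : {rmorphism k -> L}) (m : nat) (b : 'I_m -> L) : Prop :=
  alg_independent iota b
  /\ forall y : L, algebraic_over (gen_ext iota (range b)) y.

(* trdeg_k L = m; all transcendence bases of L over k have the same
   cardinality. *)
Definition has_trdeg (k L : fieldType) (iota : {rmorphism k -> L}) (m : nat) :
    Prop :=
  exists b : 'I_m -> L, is_transcendence_basis iota b.

(* The values of chi outside of G are irrelevant. *)
Definition linear_character (k : fieldType) (gT : finGroupType)
    (G : {group gT}) (chi : gT -> k) : Prop :=
  {in G, forall a, chi a != 0}
  /\ {in G &, {morph chi : a b / (a * b)%g >-> a * b}}.

(* [action] is a right action, to x (a * b)%g = to (to x a) b; as the product
   of permutations satisfies (a * b)%g i = b (a i), for a permutation group
   this is a left action with respect to the usual composition a \o b. *)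
Definition acts_by_automorphisms (k L : fieldType)
    (iota : {rmorphism k -> L}) (gT : finGroupType) (G : {group gT})
    (to : action G L) : Prop :=
  forall a : gT, a \in G ->
    [/\ {morph to^~ a : f g / f + g}, {morph to^~ a : f g / f * g}
      & forall c : k, to (iota c) a = iota c].

(* K^G, for a G-stable K. *)
Definition fixed_subfield (L : fieldType) (gT : finGroupType)
    (G : {group gT}) (to : action G L) (K : set L) : set L :=
  [set f | K f /\ forall a : gT, a \in G -> to f a = f].

(* Main.v *)
(* Write a d + b n = 1, y_i = x_i / s, K = k(y_0, ..., y_{n-1}), P = prod_i y_i
   and v = t^b s^a. Since t^d = P s^n, one has s = v^d P^-b and t = v^n P^a, so
   L = K(v), and every sigma in G multiplies v by the constant chi(sigma)^b. The
   transcendence degree forces s and t to be nonzero and the x_i to be distinct,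
   so G acts faithfully on K; by Dedekind's independence of characters there are
   alpha in K^* with sigma(alpha) = chi(sigma)^-b alpha, and an element of K of
   trace 1. Then u = alpha v is G-invariant and L = K(u).

   Put M = K^G(u). The sums of products of elements of K and of M form a
   G-stable ring. Its invariants lie in M, as one sees by inserting the element
   of trace 1; taking norms, it is a field, and so it is L. Hence L^G = M. *)

From HB Require Import structures.
Require Import Defs.
From mathcomp Require Import all_boot all_order all_algebra all_fingroup.
From mathcomp Require Import classical_sets boolp.
From mathcomp Require Import mpoly.

Set Implicit Arguments.
Unset Strict Implicit.
Unset Printing Implicit Defensive.

Import GRing.Theory.

Local Open Scope classical_set_scope.
Local Open Scope ring_scope.

(** * Subfields and algebraic closures *)

Section SubfieldType.

Variables (L : fieldType) (K : set L) (subK : is_subfield K).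

(** The proof argument lets canonical structures be attached to the membership predicate of a set
    that is only propositionally a subfield. *)
Definition subfield_pred of is_subfield K : {pred L} := mem K.

HB.instance Definition _ :=
  GRing.isDivringClosed.Build L (subfield_pred subK) subK.

(** Makes the subfield a [fieldType] of its own, so that polynomials over it and [algebraicOver]
    become available. *)
Record subfield_elt := SubfieldElt {
  subfield_val : L; _ : subfield_val \in subfield_pred subK }.

HB.instance Definition _ := [isSub for subfield_val].
HB.instance Definition _ := [Choice of subfield_elt by <:].
HB.instance Definition _ :=
  [SubChoice_isSubIntegralDomain of subfield_elt by <:].
HB.instance Definition _ :=
  [SubIntegralDomain_isSubField of subfield_elt by <:].

Lemma subfield_predP y : reflect (K y) (y \in subfield_pred subK).
Proof. exact: asboolP. Qed.

Definition subfield_inj : {rmorphism subfield_elt -> L} :=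
  (\val : subfield_elt -> L).

Lemma subfield_injP y : K y <-> exists z, subfield_inj z = y.
Proof.
split=> [/subfield_predP yK|[z <-]]; first by exists (SubfieldElt yK).
exact/subfield_predP/(valP z).
Qed.

End SubfieldType.
Section SubfieldTheory.

Variable L : fieldType.
Implicit Types (K S : set L) (x y : L).

Lemma is_subfieldP K :
  is_subfield K <->
  [/\ K 1, forall x y, K x -> K y -> K (x - y)
    & forall x y, K x -> K y -> K (x / y)].
Proof.
split=> [[K1 KB KD]|[K1 KB KD]]; split.
- exact: set_mem.
- by move=> x y /mem_set Kx /mem_set Ky; apply/set_mem/KB.
- by move=> x y /mem_set Kx /mem_set Ky; apply/set_mem/KD.
- exact: mem_set.
- by move=> x y /set_mem Kx /set_mem Ky; apply/mem_set/KB.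
- by move=> x y /set_mem Kx /set_mem Ky; apply/mem_set/KD.
Qed.

Section Closure.
Variables (K : set L) (subK : is_subfield K).
Let P := subfield_predP subK.

Lemma subfield0 : K 0. Proof. exact/P/rpred0. Qed.
Lemma subfield1 : K 1. Proof. exact/P/rpred1. Qed.
Lemma subfieldB x y : K x -> K y -> K (x - y).
Proof. by move=> /P Kx /P Ky; apply/P/rpredB. Qed.
Lemma subfieldD x y : K x -> K y -> K (x + y).
Proof. by move=> /P Kx /P Ky; apply/P/rpredD. Qed.
Lemma subfieldM x y : K x -> K y -> K (x * y).
Proof. by move=> /P Kx /P Ky; apply/P/rpredM. Qed.
Lemma subfieldV x : K x -> K x^-1.
Proof. by move=> /P Kx; apply/P; rewrite rpredV. Qed.
Lemma subfield_div x y : K x -> K y -> K (x / y).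
Proof. by move=> Kx Ky; apply/subfieldM/subfieldV. Qed.
Lemma subfield_exprz x (m : int) : K x -> K (x ^ m).
Proof.
by case: m => m /P Kx; apply/P; rewrite ?NegzE ?exprnN ?rpredV; apply: rpredX.
Qed.
Lemma subfield_sum (I : Type) (r : seq I) (Q : pred I) (f : I -> L) :
  (forall i, Q i -> K (f i)) -> K (\sum_(i <- r | Q i) f i).
Proof. by move=> Kf; apply/P; apply: rpred_sum => i /Kf/P. Qed.
Lemma subfield_prod (I : Type) (r : seq I) (Q : pred I) (f : I -> L) :
  (forall i, Q i -> K (f i)) -> K (\prod_(i <- r | Q i) f i).
Proof. by move=> Kf; apply/P; apply: rpred_prod => i /Kf/P. Qed.

End Closure.

Lemma gen_subfield_is_subfield S : is_subfield (gen_subfield S).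
Proof.
apply/is_subfieldP; split.
- by move=> M [subM _]; apply: subfield1.
- move=> x y Sx Sy M SM; have [subM _] := SM.
  by apply: subfieldB => //; [apply: Sx|apply: Sy].
- move=> x y Sx Sy M SM; have [subM _] := SM.
  by apply: subfield_div => //; [apply: Sx|apply: Sy].
Qed.

Lemma sub_gen_subfield S : S `<=` gen_subfield S.
Proof. by move=> x Sx M [_]; apply. Qed.

Lemma gen_subfield_min S K :
  is_subfield K -> S `<=` K -> gen_subfield S `<=` K.
Proof. by move=> subK SK; apply: smallest_sub. Qed.

Lemma gen_subfieldS S1 S2 :
  S1 `<=` S2 -> gen_subfield S1 `<=` gen_subfield S2.
Proof.
move=> S12; apply: gen_subfield_min; first exact: gen_subfield_is_subfield.
by move=> x /S12; apply: sub_gen_subfield.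
Qed.

Lemma polyOver_subfieldP K (subK : is_subfield K) (p : {poly L}) :
  reflect (forall i, K p`_i) (p \is a polyOver (mem K)).
Proof.
by apply: (iffP (@polyOverP _ (subfield_pred subK) p)) => pK i;
  apply/subfield_predP.
Qed.

(** Links polynomials over [L] with coefficients in [K] to polynomials over the subtype; the
    coefficients are lifted by choice. *)
Lemma algebraic_overP K (subK : is_subfield K) y :
  algebraic_over K y <-> algebraicOver (subfield_inj subK) y.
Proof.
split=> [[p [p0 /(polyOver_subfieldP subK) pK rp]]|[q q0 rq]]; last first.
  exists (map_poly (subfield_inj subK) q); split=> //.
    by rewrite map_poly_eq0.
  apply/(polyOver_subfieldP subK) => i; rewrite coef_map.
  by apply/subfield_injP; exists q`_i.
have [f fE] : {f & forall i, subfield_inj subK (f i) = p`_i}.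
  by apply: (@choice _ _ (fun i z => _ z = _)) => i; apply/subfield_injP.
have pE : map_poly (subfield_inj subK) (\poly_(i < size p) f i) = p.
  apply/polyP => i; rewrite coef_map coef_poly.
  have [ip|pi] := ltnP i (size p); first exact: fE.
  by rewrite nth_default // rmorph0.
exists (\poly_(i < size p) f i); last by rewrite pE.
by rewrite -(map_poly_eq0 (subfield_inj subK)) pE.
Qed.

Section AlgebraicClosure.
Variables (K : set L) (subK : is_subfield K).
Let E y := algebraic_overP subK y.

Lemma algebraic_over_id y : K y -> algebraic_over K y.
Proof.
move=> Ky; apply/E; have /(subfield_injP subK)[z <-] := Ky.
exact: algebraic_id.
Qed.

Lemma algebraic_over_is_subfield : is_subfield [set y | algebraic_over K y].
Proof.
apply/is_subfieldP; split=> /=.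
- exact/algebraic_over_id/(subfield1 subK).
- by move=> x y /E ax /E ay; apply/E/algebraic_sub.
- by move=> x y /E ax /E ay; apply/E/algebraic_div.
Qed.

(** The coefficients of the equation for [y] are algebraic, hence integral, over the field [K], and
    integrality passes to roots. *)
Lemma algebraic_over_trans y :
  algebraic_over [set z | algebraic_over K z] y -> algebraic_over K y.
Proof.
case=> p [p0 pK rp]; apply/E/integral_algebraic.
apply: integral_root p0 rp _ => _ /(nthP 0)[i ip <-].
apply/integral_algebraic/E.
exact: (polyOver_subfieldP algebraic_over_is_subfield _ pK).
Qed.

End AlgebraicClosure.

Lemma algebraic_overS K1 K2 y :
  K1 `<=` K2 -> algebraic_over K1 y -> algebraic_over K2 y.
Proof.
move=> K12 [p [p0 /allP pK rp]]; exists p; split=> //.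
by apply/allP => c /pK/set_mem/K12/mem_set.
Qed.

(** * Fractions and clearing denominators *)

Section Fractions.
Variables (R : comNzRingType) (phi : {rmorphism R -> L}).

Definition fractions : set L :=
  [set y | exists a b, phi b != 0 /\ y = phi a / phi b].

Lemma fractions_is_subfield : is_subfield fractions.
Proof.
have nz1 : phi 1 != 0 by rewrite rmorph1 oner_eq0.
apply/is_subfieldP; split.
- by exists 1, 1; rewrite divff.
- move=> _ _ [a [b [b0 ->]]] [c [d [d0 ->]]]; exists (a * d - c * b), (b * d).
  rewrite rmorphM mulf_neq0 // rmorphB !rmorphM; split=> //.
  by rewrite -[in LHS]mulNr addf_div // mulNr.
- move=> _ _ [a [b [b0 ->]]] [c [d [d0 ->]]].
  (* Division by 0 yields 0, so a vanishing divisor gives the fraction [phi 0 / phi 1]. *)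
  have [c0|c0] := eqVneq (phi c) 0.
    by exists 0, 1; rewrite c0 rmorph0 mul0r invr0 mulr0 mul0r.
  exists (a * d), (b * c); rewrite !rmorphM mulf_neq0 //; split=> //.
  by rewrite invf_div mulf_div.
Qed.

(** The common denominator is built up coefficient by coefficient. This turns an equation over a
    generated field into one with coefficients from [R]. *)
Lemma clear_denominators (p : {poly L}) :
  (forall i, fractions p`_i) ->
  exists (D : R) (q : {poly R}), phi D != 0 /\ map_poly phi q = phi D *: p.
Proof.
elim/poly_ind: p => [|p c IHp] pF.
  by exists 1, 0; rewrite !rmorph0 scaler0 rmorph1 oner_eq0.
have [|D [q [D0 qE]]] := IHp.
  by move=> i; have := pF i.+1; rewrite coefD coefMX coefC addr0.
have := pF 0%N; rewrite coefD coefMX coefC add0r /= => -[a [b [b0 cE]]].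
exists (D * b), ((b *: q) * 'X + (D * a)%:P).
rewrite (rmorphM phi) mulf_neq0 //; split=> //.
rewrite rmorphD /= map_polyC /= (rmorphM (map_poly phi)) /= map_polyX map_polyZ.
rewrite /= qE scalerA scalerDr -scalerAl [phi b * _]mulrC; congr (_ + _).
rewrite -mul_polyC -polyCM cE rmorphM /=; congr _%:P.
by rewrite -mulrA; congr (_ * _); rewrite mulrC divfK.
Qed.

Lemma fractions_root (p : {poly L}) y :
  (forall i, fractions p`_i) -> p != 0 -> root p y ->
  exists q : {poly R}, map_poly phi q != 0 /\ root (map_poly phi q) y.
Proof.
move=> /clear_denominators[D [q [D0 qE]]] p0 rp; exists q.
by rewrite qE scaler_eq0 negb_or D0 p0 rootZ.
Qed.

End Fractions.

(** * Relative algebraic closure, exchange property and Steinitz's lemma *)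

Definition alg_closure S : set L := [set y | algebraic_over (gen_subfield S) y].

Lemma alg_closure_is_subfield S : is_subfield (alg_closure S).
Proof. exact/algebraic_over_is_subfield/gen_subfield_is_subfield. Qed.

Lemma sub_alg_closure S : S `<=` alg_closure S.
Proof.
move=> x Sx; apply: algebraic_over_id; first exact: gen_subfield_is_subfield.
exact: sub_gen_subfield.
Qed.

Lemma alg_closure_min S1 S2 :
  S1 `<=` alg_closure S2 -> alg_closure S1 `<=` alg_closure S2.
Proof.
move=> S12 y Sy; apply: algebraic_over_trans.
  exact: gen_subfield_is_subfield.
apply: algebraic_overS Sy.
exact: gen_subfield_min (alg_closure_is_subfield S2) S12.
Qed.

Lemma alg_closureS S1 S2 :
  S1 `<=` S2 -> alg_closure S1 `<=` alg_closure S2.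
Proof. by move=> S12; apply: alg_closure_min => x /S12/sub_alg_closure. Qed.

(** Clearing denominators in the equation for [y] over K(x) gives a polynomial in two variables over
    K that vanishes at (x, y). Reading it in the other variable gives an equation for [x] over
    K(y). *)
Lemma alg_closure_exchange S x y :
  alg_closure (S `|` [set x]) y -> ~ alg_closure S y ->
  alg_closure (S `|` [set y]) x.
Proof.
move=> [p [p0 pK rp]] Sy.
have subKx := gen_subfield_is_subfield (S `|` [set x]).
have subKy := gen_subfield_is_subfield (S `|` [set y]).
have subK := gen_subfield_is_subfield S; set K := gen_subfield S in subK.
pose F := subfield_elt subK.
pose f : {rmorphism F -> L} := subfield_inj subK.
pose ev z : {rmorphism {poly F} -> L} := horner_eval z \o map_poly f.
have evE z p' : ev z p' = (map_poly f p').[z] by [].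
have evX z : ev z 'X = z by rewrite evE map_polyX hornerX.
have evC z (c : F) : ev z c%:P = f c by rewrite evE map_polyC hornerC.
have genF : gen_subfield (S `|` [set x]) `<=` fractions (ev x).
  apply: gen_subfield_min; first exact: fractions_is_subfield.
  move=> z [Sz|->]; last by exists 'X, 1; rewrite rmorph1 oner_eq0 evX divr1.
  have /(subfield_injP subK)[c <-] : K z by apply: sub_gen_subfield.
  by exists c%:P, 1; rewrite rmorph1 oner_eq0 divr1 evC.
have pF i : fractions (ev x) p`_i.
  apply: genF; exact: (polyOver_subfieldP subKx _ pK).
have [q [q0 rq]] := fractions_root pF p0 rp.
pose h := map_poly (ev y) (swapXY q).
have hE : h.[x] = (map_poly (ev x) q).[y].
  pose Q := map_poly (map_poly f) q.
  have -> : map_poly (ev x) q = map_poly (horner_eval x) Q.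
    by rewrite -map_poly_comp.
  have -> : h = map_poly (horner_eval y) (swapXY Q).
    by rewrite /Q swapXY_map -map_poly_comp.
  rewrite -horner_polyC.
  by have := horner_map (horner_eval x) Q y%:P; rewrite /= /horner_eval hornerC.
exists h; split; last by rewrite rootE hE -rootE.
- have : swapXY q != 0.
    by rewrite swapXY_eq0; apply: contraNneq q0 => ->; rewrite map_poly0.
  (* If [h] were zero, the leading coefficient of [swapXY q], a nonzero polynomial over K, would
     vanish at [y] and make [y] algebraic over K. *)
  rewrite -lead_coef_eq0 => lq0; apply/eqP => h0; apply: Sy.
  apply/(algebraic_overP subK); exists (lead_coef (swapXY q)) => //.
  have /= := congr1 (fun r : {poly L} => r`_(size (swapXY q)).-1) h0.
  by rewrite coef_map coef0 => /eqP.
- apply/(polyOver_subfieldP subKy) => i.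
  have -> : h`_i = (map_poly f (swapXY q)`_i).[y] by rewrite coef_map.
  rewrite horner_coef.
  apply: (subfield_sum subKy) => j _; apply: (subfieldM subKy); last first.
    by apply: (subfield_exprz subKy (Posz j)); apply: sub_gen_subfield; right.
  have: gen_subfield S `<=` gen_subfield (S `|` [set y]).
    by apply: gen_subfieldS => z; left.
  by apply; rewrite coef_map; apply/(subfield_injP subK); eexists.
Qed.

(** Independence in sequential form: each entry is transcendental over [S] and its predecessors.
    This suits an exchange that moves entries into [S] one by one. *)
Fixpoint alg_free S (bs : seq L) : Prop :=
  if bs is b :: bs' then
    ~ alg_closure S b /\ alg_free (S `|` [set b]) bs'
  else True.

Lemma alg_free_rcons S bs b :
  alg_free S bs -> ~ alg_closure (S `|` [set` bs]) b -> alg_free S (rcons bs b).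
Proof.
elim: bs S => [|c bs IHbs] S /=.
  by move=> _ Sb; split=> // Sb'; apply: Sb; apply: alg_closureS Sb'; left.
move=> [Sc fbs] Sb; split=> //; apply: IHbs => // Sb'; apply: Sb.
apply: alg_closureS Sb' => z [[Sz|->]|zbs].
- by left.
- by right=> /=; rewrite inE eqxx.
- by right=> /=; rewrite inE zbs orbT.
Qed.

(** Adjoin the entries of [zs] to [S] in turn; at the entry where [b] first becomes algebraic, the
    exchange property trades that entry for [b]. *)
Lemma alg_closure_swap S zs b :
  alg_closure (S `|` [set` zs]) b -> ~ alg_closure S b ->
  exists zs1 z zs2, zs = zs1 ++ z :: zs2
    /\ alg_closure (S `|` [set b] `|` [set` zs1 ++ zs2]) z.
Proof.
elim: zs S => [|z zs IHzs] S Sb nSb.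
  by case: nSb; apply: alg_closureS Sb => y [].
have [Szb|nSzb] := pselect (alg_closure (S `|` [set z]) b).
  exists [::], z, zs; split=> //.
  by apply: alg_closureS (alg_closure_exchange Szb nSb) => y; left.
have [|zs1 [z' [zs2 [-> clz']]]] := IHzs (S `|` [set z]) _ nSzb.
  apply: alg_closureS Sb => y [Sy|]; first by left; left.
  by rewrite /= inE => /orP[/eqP->|yzs]; [left; right|right].
exists (z :: zs1), z', zs2; split=> //.
apply: alg_closureS clz' => y [[[Sy|->]|yb]|yzs].
- by left; left.
- by right; rewrite /= inE eqxx.
- by left; right.
- by right; rewrite /= inE; apply/orP; right.
Qed.

(** Each entry of [bs] moves into [S] and displaces one entry of [zs] without shrinking the
    closure. *)
Lemma steinitz S bs zs :
  alg_free S bs -> (forall b, b \in bs -> alg_closure (S `|` [set` zs]) b) ->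
  (size bs <= size zs)%N.
Proof.
elim: bs S zs => // b bs IHbs S zs [nSb fbs] bszs.
have [|zs1 [z [zs2 [zsE clz]]]] := @alg_closure_swap S zs b _ nSb.
  by apply: bszs; rewrite inE eqxx.
rewrite zsE size_cat addnS -size_cat ltnS; apply: IHbs fbs _ => c cbs.
have: alg_closure (S `|` [set` zs]) c by apply: bszs; rewrite inE cbs orbT.
apply: alg_closure_min => y [Sy|]; first by apply: sub_alg_closure; left; left.
rewrite zsE /= mem_cat inE orbCA => /orP[/eqP-> //|yzs].
by apply: sub_alg_closure; right; rewrite /= mem_cat.
Qed.

End SubfieldTheory.

(** * Algebraic independence and bounds on the transcendence degree *)

Section AlgebraicIndependence.

Lemma mpoly_rmorph_ext (R S : comNzRingType) (m : nat)
    (f g : {rmorphism {mpoly R[m]} -> S}) :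
  (forall c, f c%:MP = g c%:MP) -> (forall i, f 'X_i = g 'X_i) -> f =1 g.
Proof.
move=> fgC fgX p; rewrite (mpolyE p) !rmorph_sum; apply: eq_bigr => e _.
rewrite -mul_mpolyC !rmorphM fgC mpolyXE_id !rmorph_prod; congr (_ * _).
by apply: eq_bigr => i _; rewrite !rmorphXn fgX.
Qed.

Variables (k L : fieldType) (iota : {rmorphism k -> L}).

(** Polynomials in m+1 variables are polynomials in the last variable over those in the first m, so
    an equation for the last entry of [b] over the others is a relation among all entries. *)
Lemma alg_independent_root m (b : 'I_m.+1 -> L) (q : {poly {mpoly k[m]}}) :
  alg_independent iota b ->
  root (map_poly (mmap iota (b \o lift ord_max)) q) (b ord_max) -> q = 0.
Proof.
pose incl : {rmorphism {mpoly k[m]} -> {mpoly k[m.+1]}} :=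
  mmap (@mpolyC m.+1 k) (fun j => 'X_(lift ord_max j)).
pose coefC : {rmorphism k -> {poly {mpoly k[m]}}} := polyC \o @mpolyC m k.
pose uni : {rmorphism {mpoly k[m.+1]} -> {poly {mpoly k[m]}}} :=
  mmap coefC (fun i => if unlift ord_max i is Some j then ('X_j)%:P else 'X).
pose ev : {rmorphism {mpoly k[m.+1]} -> L} := mmap iota b.
have uni_incl : uni \o incl =1 polyC.
  apply: mpoly_rmorph_ext => [c|i] /=.
    by rewrite /incl /uni /= !mmapC.
  by rewrite /incl /uni /= !mmapX !mmap1U mmapX mmap1U liftK.
have ev_incl : ev \o incl =1 mmap iota (b \o lift ord_max).
  apply: mpoly_rmorph_ext => [c|i] /=.
    by rewrite /incl /ev /= !mmapC.
  by rewrite /incl /ev /= !mmapX !mmap1U mmapX mmap1U.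
move=> ind_b; rewrite rootE -(eq_map_poly ev_incl) map_poly_comp.
have -> : b ord_max = ev 'X_ord_max by rewrite /ev /= mmapX mmap1U.
(* The image of [q] under [incl], evaluated at the last variable, is killed by [ev], hence zero by
   independence; [uni] turns it back into [q]. *)
rewrite horner_map => /eqP/ind_b/(congr1 uni).
rewrite rmorph0 -horner_map -map_poly_comp (eq_map_poly uni_incl).
by rewrite /uni /= mmapX mmap1U unlift_none -/(comp_poly 'X q) comp_polyXr.
Qed.

Lemma alg_independent_restrict m (b : 'I_m.+1 -> L) :
  alg_independent iota b -> alg_independent iota (b \o lift ord_max).
Proof.
move=> ind_b p p0; apply: (@polyC_inj {mpoly k[m]}).
by apply: (alg_independent_root ind_b); rewrite map_polyC /= p0 root0.
Qed.

Lemma alg_independent_free m (b : 'I_m -> L) :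
  alg_independent iota b ->
  alg_free (range iota) [seq b i | i <- enum 'I_m].
Proof.
elim: m b => [|m IHm] b ind_b; first by rewrite enum_ord0.
have wE : b \o widen_ord (leqnSn m) =1 b \o lift ord_max.
  by move=> i /=; congr b; apply/val_inj; exact/esym/lift_max.
rewrite enum_ordSr map_rcons -map_comp (eq_map wE); apply: alg_free_rcons.
  exact/IHm/alg_independent_restrict.
pose ev : {rmorphism {mpoly k[m]} -> L} := mmap iota (b \o lift ord_max).
set S := _ `|` _ => -[p [p0 pK rp]].
(* The field generated by the first m entries lies in the fractions of polynomials in them, so an
   equation for the last entry can be given polynomial coefficients. *)
have subF : gen_subfield S `<=` fractions ev.
  apply: gen_subfield_min; first exact: fractions_is_subfield.
  move=> _ [[c _ <-]|/mapP[i _ ->]]; [exists c%:MP, 1|exists 'X_i, 1];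
    rewrite rmorph1 oner_eq0 divr1; split=> //.
  - by rewrite /ev /= mmapC.
  - by rewrite /ev /= mmapX mmap1U.
have pF i : fractions ev p`_i.
  by apply: subF; apply: (polyOver_subfieldP (gen_subfield_is_subfield S) _ pK).
have [q [q0 rq]] := fractions_root pF p0 rp.
by move: q0; rewrite (alg_independent_root ind_b rq) rmorph0 eqxx.
Qed.

(** A transcendence basis is free and lies in the closure of [zs], so Steinitz's lemma bounds its
    length. *)
Lemma has_trdeg_le m (zs : seq L) :
  has_trdeg iota m -> alg_closure (range iota `|` [set` zs]) = setT ->
  (m <= size zs)%N.
Proof.
move=> [b [ind_b _]] clT.
have := steinitz (alg_independent_free ind_b) (zs := zs).
by rewrite size_map size_enum_ord; apply=> y _; rewrite clT.
Qed.

End AlgebraicIndependence.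

(** * Consequences of the transcendence degree *)

(** For e > 0, [y] is a root of X^e - y^e; a negative exponent is reduced to this case by
    inversion. *)
Lemma alg_closure_root (L : fieldType) (S : set L) (m : int) (y : L) :
  m != 0 -> alg_closure S (y ^ m) -> alg_closure S y.
Proof.
have subA := alg_closure_is_subfield S.
have pos (e : nat) : (0 < e)%N -> alg_closure S (y ^+ e) -> alg_closure S y.
  move=> e0 ye; apply: algebraic_over_trans.
    exact: gen_subfield_is_subfield.
  exists ('X^e - (y ^+ e)%:P); split.
  - by rewrite -size_poly_eq0 size_XnsubC.
  - apply/(polyOver_subfieldP subA) => i; rewrite coefB coefXn coefC.
    apply: (subfieldB subA).
      by case: eqP => _; [apply: subfield1 subA|apply: subfield0 subA].
    by case: eqP => // _; apply: subfield0 subA.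
  - by rewrite rootE !hornerE subrr.
case: m => [e|e] m0; first by apply: pos; rewrite lt0n.
by rewrite NegzE => /(subfieldV subA); rewrite invr_expz opprK; apply: pos.
Qed.

Lemma has_trdeg_le_gen (k L : fieldType) (iota : {rmorphism k -> L}) m
    (S : set L) (zs : seq L) :
  has_trdeg iota m -> gen_ext iota S = setT ->
  S `<=` alg_closure (range iota `|` [set` zs]) -> (m <= size zs)%N.
Proof.
move=> trL genL Szs; apply: has_trdeg_le trL _.
apply/seteqP; split=> // y _; have : gen_ext iota S y by rewrite genL.
apply: gen_subfield_min y; first exact: alg_closure_is_subfield.
by move=> y [iy|/Szs//]; apply: sub_alg_closure; left.
Qed.

Section Nondegenerate.

Variables (k : fieldType) (n : nat) (n_gt0 : (0 < n)%N) (d : int).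
Variables (d_coprime : coprimez d n%:Z) (L : fieldType).
Variables (iota : {rmorphism k -> L}) (t s : L) (x : 'I_n -> L).
Hypothesis L_gen : gen_ext iota ([set t; s] `|` range x) = [set: L].
Hypothesis L_trdeg : has_trdeg iota n.+1.
Hypothesis t_rel : t ^ d = \prod_(i < n) x i.

Let C (zs : seq L) := alg_closure (range iota `|` [set` zs]).

(** Transcendence degree n+1 excludes algebraic generation by n elements; the contradictions below
    come from this bound. *)
Let few_generators zs : (size zs <= n)%N ->
  C zs t -> C zs s -> (forall i, C zs (x i)) -> False.
Proof.
move=> zsn Ct Cs Cx; suff: (n < size zs)%N by rewrite ltnNge zsn.
apply: has_trdeg_le_gen L_trdeg L_gen _.
by move=> y [[->|->]|[i _ <-]]; [exact: Ct|exact: Cs|exact: Cx].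
Qed.

Let algebraic_t zs : d != 0 -> (forall i, C zs (x i)) -> C zs t.
Proof.
move=> d0 Cx; apply: alg_closure_root d0 _; rewrite t_rel.
by apply: (subfield_prod (alg_closure_is_subfield _)) => i _; apply: Cx.
Qed.

Let C0 zs : C zs 0. Proof. exact: subfield0 (alg_closure_is_subfield _). Qed.
Let C1 zs : C zs 1. Proof. exact: subfield1 (alg_closure_is_subfield _). Qed.
Let C_in zs y : y \in zs -> C zs y.
Proof. by move=> yzs; apply: sub_alg_closure; right. Qed.

(** Coprimality reads gcd(0, n) = n = 1. The exponent 0 is treated apart, since [t] is then not a
    root of an algebraic equation over the [x i]. *)
Let exponent0 : d = 0 -> n = 1%N.
Proof. by move=> d0; move: d_coprime; rewrite d0 /coprimez gcd0z => /eqP[]. Qed.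

Let index_unique (i j : 'I_n) : d = 0 -> i = j.
Proof.
move=> d0; have ord_0 (l : 'I_n) : l = 0%N :> nat.
  have := ltn_ord l; rewrite [X in (_ < X)%N](exponent0 d0) ltnS leqn0.
  by move/eqP.
by apply/val_inj; rewrite /= !ord_0.
Qed.

Let x_exponent0 i : d = 0 -> x i = 1.
Proof.
move=> d0; move: t_rel; rewrite d0 expr0z (bigD1 i) //= big1 ?mulr1 // => j.
by case/eqP; apply: index_unique.
Qed.

(** Otherwise every [x i], and then [t] as a d-th root of their product, is algebraic over the n or
    fewer entries of [zs]. *)
Let x_irredundant i0 zs : d != 0 -> s \in zs -> (size zs <= n)%N ->
  (forall i, i != i0 -> x i \in zs) -> ~ C zs (x i0).
Proof.
move=> d0 szs zsn xzs Cx0; have Cx i : C zs (x i).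
  by have [->//|/xzs/C_in] := eqVneq i i0.
by apply: (few_generators zsn) => //; [apply: algebraic_t|apply: C_in].
Qed.

Let others i0 := s :: [seq x i | i <- rem i0 (enum 'I_n)].

Let size_others i0 : (size (others i0) <= n)%N.
Proof. by rewrite /= size_map size_rem ?mem_enum // size_enum_ord prednK. Qed.

Let mem_others i0 i : i != i0 -> x i \in others i0.
Proof.
move=> ii0; rewrite inE; apply/orP; right; apply: map_f.
by rewrite mem_rem_uniq ?enum_uniq // !inE ii0 mem_enum.
Qed.

(** A repeated value [x i] would already occur in [others i]. *)
Lemma x_inj : injective x.
Proof.
have [d0|d0] := eqVneq d 0 => i j xij; first exact: index_unique.
apply/eqP/negPn/negP => ij.
apply: (@x_irredundant i (others i)); rewrite ?mem_head //.
  exact: mem_others.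
by rewrite xij; apply/C_in/mem_others; rewrite eq_sym.
Qed.

(** If [s] vanished, the n elements [x i], or [t] alone when d = 0, would generate L
    algebraically. *)
Lemma s_neq0 : s != 0.
Proof.
apply/eqP => s0; have [d0|d0] := eqVneq d 0.
  by apply: (@few_generators [:: t]); rewrite ?s0 // => *;
    rewrite ?x_exponent0 //; apply: C_in; rewrite mem_head.
have Cx i : C [seq x i | i <- enum 'I_n] (x i).
  by apply/C_in/map_f; rewrite mem_enum.
apply: (few_generators _ (algebraic_t d0 Cx) _ Cx).
  by rewrite size_map size_enum_ord.
by rewrite s0.
Qed.

Lemma t_neq0 : t != 0.
Proof.
apply/eqP => t0; have [d0|d0] := eqVneq d 0.
  by apply: (@few_generators [:: s]); rewrite ?t0 // => *;
    rewrite ?x_exponent0 //; apply: C_in; rewrite mem_head.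
(* For nonzero d of either sign [0 ^ d] is 0, so some [x i] vanishes and becomes redundant. *)
have /esym/eqP := t_rel; rewrite t0 exp0rz (negPf d0).
move=> /prodf_eq0[i _ /eqP xi0].
apply: (@x_irredundant i (others i)); rewrite ?mem_head //.
  exact: mem_others.
by rewrite xi0.
Qed.

End Nondegenerate.

(** * Fixed subfields *)

(* The library states these facts for actions on finite types only. *)
Section ActionOnType.

Variables (gT : finGroupType) (G : {group gT}) (T : Type) (to : action G T).

Lemma to_inj a : injective (to^~ a).
Proof. by case: to => f fP x y; apply: (proj1 fP). Qed.

Lemma toM a b x : a \in G -> b \in G -> to x (a * b)%g = to (to x a) b.
Proof. by case: to => f fP aG bG; apply: (proj2 fP). Qed.

Lemma to1 x : to x 1%g = x.
Proof. by apply: (@to_inj 1%g); rewrite -toM // mulg1. Qed.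

End ActionOnType.

Section AutomorphismAction.

Variables (k L : fieldType) (iota : {rmorphism k -> L}) (gT : finGroupType).
Variables (G : {group gT}) (to : action G L).
Hypothesis to_aut : acts_by_automorphisms iota to.

(** Opens the theory of ring morphisms to the action. Injectivity makes the image of 1 nonzero, and
    multiplicativity then forces it to be 1. *)
Lemma act_rmorphism a :
  a \in G -> exists f : {rmorphism L -> L}, to^~ a =1 f.
Proof.
move=> aG; have [aD aM _] := to_aut aG.
have a0 : to 0 a = 0 by apply: (addrI (to 0 a)); rewrite -aD !addr0.
have a1 : to 1 a = 1.
  have nz : to 1 a != 0 by rewrite -a0 (inj_eq (@to_inj _ _ _ to a)) oner_eq0.
  by apply: (mulfI nz); rewrite -aM !mulr1.
have aB : zmod_morphism (to^~ a).
  move=> f g; apply/eqP; rewrite eq_sym subr_eq -aD.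
  by rewrite subrK.
have aMon : monoid_morphism (to^~ a) by [].
pose f : {rmorphism L -> L} := HB.pack (to^~ a)
  (GRing.isZmodMorphism.Build L L (to^~ a) aB)
  (GRing.isMonoidMorphism.Build L L (to^~ a) aMon).
by exists f.
Qed.

Lemma act_trace a z :
  a \in G -> to (\sum_(g in G) to z g) a = \sum_(g in G) to z g.
Proof.
move=> aG; have [f fE] := act_rmorphism aG.
rewrite fE rmorph_sum [RHS](reindex_inj (mulIg a)) /=.
apply: eq_big => g; first by rewrite groupMr.
by move=> gG; rewrite -fE toM.
Qed.

(** * Dedekind independence, semi-invariants and an element of trace 1 *)

Section Faithful.

Variables (K : set L) (subK : is_subfield K).
Hypothesis K_faithful :
  forall a, a \in G -> a != 1%g -> exists2 w, K w & to w a != w.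

Lemma act_neq a b :
  a \in G -> b \in G -> a != b -> exists2 w, K w & to w a != to w b.
Proof.
move=> aG bG ab; have [||w Kw wab] := K_faithful (a := (a * b^-1)%g).
- by rewrite groupM ?groupV.
- by apply: contraNneq ab => abV; rewrite -(mulgKV b a) abV mul1g.
exists w => //; apply: contraNneq wab => wab.
by rewrite toM ?groupV // wab -toM ?groupV // mulgV to1.
Qed.

(** Induction on [#|A|]: for [w] in [K] separating [b] from [a], subtract [to w a] times the
    relation at [z] from the relation at [w * z]; the term of [a] cancels. *)
Lemma dedekind_independence (A : {set gT}) (c : gT -> L) :
  {subset A <= G} ->
  (forall z, K z -> \sum_(a in A) c a * to z a = 0) ->
  forall a, a \in A -> c a = 0.
Proof.
move: {2}#|A| (leqnn #|A|) => m; elim: m A c => [|m IHm] A c.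
  by rewrite leqn0 cards_eq0 => /eqP-> _ _ a; rewrite inE.
move=> Am AG cA a aA; have aG := AG a aA.
have ca b : b \in A -> b != a -> c b = 0.
  move=> bA ba; have bG := AG b bA.
  have [w Kw wab] := act_neq bG aG ba.
  have A'm : (#|A :\ a| <= m)%N by move: Am; rewrite (cardsD1 a) aA.
  have A'G : {subset A :\ a <= G} by move=> g /setD1P[_ /AG].
  have := IHm _ (fun g => c g * (to w g - to w a)) A'm A'G.
  move=> /(_ _ b); rewrite !inE ba bA => c0.
  apply: (mulIf (x := to w b - to w a)); first by rewrite subr_eq0.
  rewrite mul0r; apply: c0 => // z Kz.
  transitivity (\sum_(g in A) c g * (to w g - to w a) * to z g).
    by rewrite [RHS](big_setD1 a) //= subrr mulr0 mul0r add0r.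
  transitivity (\sum_(g in A) c g * to (w * z) g
                - to w a * \sum_(g in A) c g * to z g); last first.
    by rewrite !cA ?mulr0 ?subr0 //; apply: subfieldM.
  rewrite mulr_sumr -sumrB; apply: eq_bigr => g gA.
  have [_ gM _] := to_aut (AG g gA).
  by rewrite gM mulrBr mulrBl -!mulrA [to w a * _]mulrCA.
(* Only the term of [a] survives, and [z = 1] isolates its coefficient. *)
have := cA 1 (subfield1 subK); rewrite (big_setD1 a) //= big1 => [|b].
  have [f fE] := act_rmorphism aG.
  by rewrite addr0 fE rmorph1 mulr1.
by rewrite !inE => /andP[ba bA]; rewrite ca ?mul0r.
Qed.

Lemma twisted_sum_neq0 (c : gT -> L) :
  c 1%g != 0 -> exists2 z, K z & \sum_(g in G) c g * to z g != 0.
Proof.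
move=> c1; apply: contrapT => nz; case/eqP: c1.
apply: (@dedekind_independence G) (group1 G) => // z Kz.
by apply/eqP/negPn/negP => cz; apply: nz; exists z.
Qed.

Hypothesis K_stable : forall a z, a \in G -> K z -> K (to z a).

(** [alpha] is the Lagrange resolvent of a [z] at which it does not vanish; right translation by [a]
    in the index absorbs the factor [theta a]. *)
Lemma semi_invariant_exists (theta : gT -> L) :
    {in G &, {morph theta : a b / (a * b)%g >-> a * b}} ->
    (forall a, a \in G -> theta a != 0) ->
    (forall a, a \in G -> K (theta a)) ->
    (forall a b, a \in G -> b \in G -> to (theta a) b = theta a) ->
  exists alpha, [/\ K alpha, alpha != 0
    & forall a, a \in G -> theta a * to alpha a = alpha].
Proof.
move=> thM th0 Kth thG; have [z Kz nz] := twisted_sum_neq0 (th0 _ (group1 G)).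
exists (\sum_(g in G) theta g * to z g); split=> // [|a aG].
  apply: (subfield_sum subK) => g gG.
  by apply: (subfieldM subK); [apply: Kth|apply: K_stable].
have [f fE] := act_rmorphism aG.
rewrite fE rmorph_sum mulr_sumr [RHS](reindex_inj (mulIg a)) /=.
apply: eq_big => g; first by rewrite groupMr.
move=> gG; rewrite rmorphM -!fE thG // thM // toM //.
by rewrite mulrCA mulrA.
Qed.

(** The resolvent of the trivial character is a trace; a nonzero trace is invariant and can be
    divided out. *)
Lemma trace_eq1 : exists2 z, K z & \sum_(g in G) to z g = 1.
Proof.
have [|z Kz] := @twisted_sum_neq0 (fun=> 1); first exact: oner_neq0.
under eq_bigr do rewrite mul1r.
set w := \sum_(g in G) _ => w0.
have Kw : K w by apply: (subfield_sum subK) => g gG; apply: K_stable.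
have wG a : a \in G -> to w a = w by apply: act_trace.
exists (z / w); first exact: (subfield_div subK).
rewrite -(divff w0) [in RHS]/w mulr_suml; apply: eq_bigr => g gG.
have [f fE] := act_rmorphism gG.
by rewrite fE fmorph_div -!fE wG.
Qed.

(** * The ring generated by [K] and [M] *)

Section Compositum.

Variable M : set L.
Hypotheses (subM : is_subfield M).
Hypothesis M_fixed : forall a m, a \in G -> M m -> to m a = m.
Hypothesis M_KG : fixed_subfield to K `<=` M.

Inductive compositum : set L :=
| Compositum0 : compositum 0
| CompositumD z m f :
    K z -> M m -> compositum f -> compositum (z * m + f).

Lemma compositum_add f g : compositum f -> compositum g -> compositum (f + g).
Proof.
elim=> [|z m f' Kz Mm _ IHf] Cg; first by rewrite add0r.
by rewrite -addrA; apply: CompositumD => //; apply: IHf.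
Qed.

Lemma compositum_scale z m f :
  K z -> M m -> compositum f -> compositum (z * m * f).
Proof.
move=> Kz Mm; elim=> [|z' m' f' Kz' Mm' _ IHf].
  by rewrite mulr0; apply: Compositum0.
rewrite mulrDr mulrACA; apply: CompositumD => //.
  exact: (subfieldM subK).
exact: (subfieldM subM).
Qed.

Lemma compositum_mul f g : compositum f -> compositum g -> compositum (f * g).
Proof.
elim=> [|z m f' Kz Mm _ IHf] Cg; first by rewrite mul0r; apply: Compositum0.
by rewrite mulrDl; apply: compositum_add; [apply: compositum_scale|apply: IHf].
Qed.

Lemma compositum_K z : K z -> compositum z.
Proof.
move=> Kz; rewrite -[z]mulr1 -[_ * 1]addr0; apply: CompositumD => //.
  exact: subfield1 subM.
exact: Compositum0.
Qed.

Lemma compositum_M m : M m -> compositum m.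
Proof.
move=> Mm; rewrite -[m]mul1r -[1 * _]addr0; apply: CompositumD => //.
  exact: subfield1 subK.
exact: Compositum0.
Qed.

Lemma compositum_act a f : a \in G -> compositum f -> compositum (to f a).
Proof.
move=> aG; have [r rE] := act_rmorphism aG.
elim=> [|z m f' Kz Mm _ IHf]; first by rewrite rE rmorph0; apply: Compositum0.
rewrite rE rmorphD rmorphM -!rE (M_fixed aG Mm).
by apply: CompositumD => //; apply: K_stable.
Qed.

(** [G] fixes [M], so the trace is [M]-linear and reduces to traces of elements of [K]; these lie in
    [fixed_subfield to K], hence in [M]. *)
Lemma compositum_trace z f :
  K z -> compositum f -> M (\sum_(g in G) to (z * f) g).
Proof.
move=> Kz; elim=> [|z' m f' Kz' Mm _ IHf].
  apply: (subfield_sum subM) => g gG; have [r rE] := act_rmorphism gG.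
  by rewrite mulr0 rE rmorph0; apply: subfield0 subM.
have -> : \sum_(g in G) to (z * (z' * m + f')) g =
    (\sum_(g in G) to (z * z') g) * m + \sum_(g in G) to (z * f') g.
  rewrite mulr_suml -big_split; apply: eq_bigr => g gG.
  have [r rE] := act_rmorphism gG.
  by rewrite mulrDr mulrA !rE rmorphD [r (_ * m)]rmorphM -!rE (M_fixed gG Mm).
apply: (subfieldD subM) => //; apply: (subfieldM subM) => //; apply: M_KG.
have Kzz' : K (z * z') by apply: (subfieldM subK).
split=> [|a aG]; last exact: act_trace.
by apply: (subfield_sum subK) => g gG; apply: K_stable.
Qed.

(** For [z] of trace 1, an invariant [f] equals the trace of [z * f]. *)
Lemma compositum_fixed f :
  compositum f -> (forall a, a \in G -> to f a = f) -> M f.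
Proof.
move=> Cf fG; have [z Kz trz] := trace_eq1.
suff -> : f = \sum_(g in G) to (z * f) g by apply: compositum_trace.
rewrite -[LHS]mul1r -trz mulr_suml; apply: eq_bigr => g gG.
have [r rE] := act_rmorphism gG.
by rewrite [RHS]rE rmorphM -!rE fG.
Qed.

(* The norm of f is a nonzero invariant of the compositum, hence lies in M. *)
Lemma compositum_inv f : compositum f -> compositum f^-1.
Proof.
move=> Cf; have [->|f0] := eqVneq f 0.
  by rewrite invr0; apply: Compositum0.
have Cprod (Q : pred gT) : compositum (\prod_(g in G | Q g) to f g).
  apply: big_ind => [||g /andP[gG _]]; first exact: compositum_K (subfield1 _).
    exact: compositum_mul.
  exact: compositum_act.
set N := \prod_(g in G) to f g.
have NE : N = f * \prod_(g in G | g != 1%g) to f g.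
  by rewrite /N (bigD1 1%g) //= to1.
have MN : M N.
  apply: compositum_fixed => [|a aG].
    by rewrite NE; apply: compositum_mul.
  have [r rE] := act_rmorphism aG.
  rewrite rE rmorph_prod [RHS](reindex_inj (mulIg a)) /=.
  apply: eq_big => g; first by rewrite groupMr.
  by move=> gG; rewrite -rE toM.
have N0 : N != 0.
  apply/prodf_neq0 => g gG; have [r rE] := act_rmorphism gG.
  by rewrite rE fmorph_eq0.
have -> : f^-1 = (\prod_(g in G | g != 1%g) to f g) * N^-1.
  by apply: (mulfI f0); rewrite mulrA -NE !divff.
by apply: compositum_mul => //; apply/compositum_M/(subfieldV subM).
Qed.

Lemma compositum_is_subfield : is_subfield compositum.
Proof.
have C1 := compositum_K (subfield1 subK).
apply/is_subfieldP; split=> // f g Cf Cg; last first.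
  exact/compositum_mul/compositum_inv.
apply: compositum_add => //; rewrite -mulN1r -[-1]mulr1.
apply: compositum_scale => //; last exact: subfield1 subM.
by rewrite -[-1]add0r; apply: (subfieldB subK);
  [apply: subfield0 subK|apply: subfield1 subK].
Qed.

End Compositum.

Lemma fixed_subfield_adjoin u :
    (forall a, a \in G -> to u a = u) ->
    gen_subfield (K `|` [set u]) = setT ->
  fixed_subfield to setT = gen_subfield (fixed_subfield to K `|` [set u]).
Proof.
move=> uG genL; set M := gen_subfield (_ `|` [set u]).
have subM : is_subfield M := gen_subfield_is_subfield _.
have M_fixed a m : a \in G -> M m -> to m a = m.
  (* The elements fixed by [a] form a subfield, so checking the generators of [M] is enough. *)
  move=> aG; suff: M `<=` [set y | to y a = y] by apply.
  apply: gen_subfield_min => [|y [[_ yG]|->]]; [|exact: yG|exact: uG].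
  have [r rE] := act_rmorphism aG.
  apply/is_subfieldP; split=> /= [|x y|x y]; rewrite !rE ?rmorph1 //.
    by move=> xE yE; rewrite rmorphB xE yE.
  by move=> xE yE; rewrite fmorph_div xE yE.
have M_KG : fixed_subfield to K `<=` M.
  by move=> m Km; apply: sub_gen_subfield; left.
apply/seteqP; split=> [f [_ fG]|f Mf]; last by split=> // a aG; apply: M_fixed.
apply: compositum_fixed => //.
(* The compositum is a subfield containing [K] and [u], hence all of [L]. *)
suff: setT `<=` compositum M by apply.
rewrite -genL; apply: gen_subfield_min => [|y [Ky|->]].
- exact: compositum_is_subfield.
- exact: compositum_K.
- by apply: compositum_M => //; apply: sub_gen_subfield; right.
Qed.

End Faithful.

End AutomorphismAction.

(** * The semi-invariant monomial and the invariant generator *)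

Lemma linear_character_exprz (k : fieldType) (gT : finGroupType)
    (G : {group gT}) (chi : gT -> k) (b : int) :
  linear_character G chi ->
  {in G &, {morph (fun a => chi a ^ b) : a a' / (a * a')%g >-> a * a'}}.
Proof. by move=> [_ chiM] a a' aG a'G; rewrite chiM // expfzMl. Qed.

Theorem theorem1p5 (k : fieldType) (n : nat) (n_gt0 : (0 < n)%N)
    (d : int) (d_coprime : coprimez d n%:Z)
    (L : fieldType) (iota : {rmorphism k -> L})
    (t s : L) (x : 'I_n -> L)
    (L_gen : gen_ext iota ([set t; s] `|` range x) = [set: L])
    (L_trdeg : has_trdeg iota n.+1)
    (t_rel : t ^ d = \prod_(i < n) x i)
    (G : {group 'S_n}) (chi : 'S_n -> k) (chi_lin : linear_character G chi)
    (chi_d : forall a : 'S_n, a \in G -> chi a ^ d = 1)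
    (to : action G L) (to_aut : acts_by_automorphisms iota to)
    (to_t : forall a : 'S_n, a \in G -> to t a = iota (chi a) * t)
    (to_s : forall a : 'S_n, a \in G -> to s a = s)
    (to_x : forall (a : 'S_n) (i : 'I_n), a \in G -> to (x i) a = x (a i)) :
  exists u : L,
    (forall a : 'S_n, a \in G -> to u a = u)
    /\ fixed_subfield to [set: L]
       = gen_subfield
           (fixed_subfield to (gen_ext iota (range (fun i => x i / s)))
            `|` [set u]).
Proof.
have s0 := s_neq0 n_gt0 d_coprime L_gen L_trdeg t_rel.
have t0 := t_neq0 n_gt0 d_coprime L_gen L_trdeg t_rel.
have xI := x_inj n_gt0 d_coprime L_gen L_trdeg t_rel.
set K := gen_ext iota _.
have subK : is_subfield K := gen_subfield_is_subfield _.
have Kiota c : K (iota c) by apply: sub_gen_subfield; left; exists c.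
have Ky i : K (x i / s) by apply: sub_gen_subfield; right; exists i.
have to_y a i : a \in G -> to (x i / s) a = x (a i) / s.
  move=> aG; have [r rE] := act_rmorphism to_aut aG.
  by rewrite rE fmorph_div -!rE to_x // to_s.
(* A nontrivial permutation moves some index i, and injectivity of [x] makes it move [x i / s]. *)
have K_faithful a : a \in G -> a != 1%g -> exists2 w, K w & to w a != w.
  move=> aG a1; have /existsP[i ai] : [exists i, a i != i].
    rewrite -negb_forall; apply: contra a1 => /forallP aE.
    by apply/eqP/permP => i; rewrite perm1; apply/eqP.
  exists (x i / s) => //; rewrite to_y //.
  by rewrite (inj_eq (mulIf (invr_neq0 s0))) (inj_eq xI).
have K_stable a z : a \in G -> K z -> K (to z a).
  move=> aG; have [r rE] := act_rmorphism to_aut aG.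
  suff: K `<=` [set y | K (to y a)] by apply.
  apply: gen_subfield_min => [|y [[c _ <-]|[i _ <-]]].
  - apply/is_subfieldP; split=> /= [|f g|f g]; rewrite !rE.
    + by rewrite rmorph1; apply: subfield1 subK.
    + by rewrite rmorphB; apply: subfieldB.
    + by rewrite fmorph_div; apply: subfield_div.
  - by have [_ _ aC] := to_aut a aG; rewrite /= aC.
  - by rewrite /= to_y.
have [[a b] bezout] : exists ab : int * int, ab.1 * d + ab.2 * n%:Z = 1.
  by have [a [b E]] := Bezoutz d n; exists (a, b); rewrite E; apply/eqP.
rewrite /= in bezout.
(* This is the factor by which [g] multiplies t^b s^a; its values are constants, hence in [K] and
   fixed by [G]. *)
pose theta g := iota (chi g ^ b).
have thG g h : g \in G -> h \in G -> to (theta g) h = theta g.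
  by move=> _ hG; have [_ _] := to_aut h hG; apply.
have th0 g : g \in G -> theta g != 0.
  by move=> gG; rewrite fmorph_eq0 expfz_neq0 //; apply: chi_lin.1.
have thM : {in G &, {morph theta : g h / (g * h)%g >-> g * h}}.
  move=> g h gG hG.
  by rewrite /theta (linear_character_exprz b chi_lin) ?rmorphM.
have [alpha [Kalpha alpha0 to_alpha]] :=
  semi_invariant_exists to_aut subK K_faithful K_stable thM th0
    (fun g _ => Kiota _) thG.
(* Monomials in [t] and [s] reduce the identities below to arithmetic of exponents. *)
pose mon i j := t ^ i * s ^ j.
have monM i j i' j' : mon i j * mon i' j' = mon (i + i') (j + j').
  by rewrite /mon mulrACA !expfzDr.
have monX i j e : mon i j ^ e = mon (i * e) (j * e).
  by rewrite /mon expfzMl !exprz_exp.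
pose v := mon b a.
have to_v g : g \in G -> to v g = theta g * v.
  move=> gG; have [r rE] := act_rmorphism to_aut gG.
  rewrite /v /mon rE rmorphM !fmorphXz -!rE to_s // to_t // expfzMl -mulrA.
  by rewrite -fmorphXz.
have uG g : g \in G -> to (alpha * v) g = alpha * v.
  move=> gG; have [_ aM _] := to_aut g gG.
  by rewrite aM to_v // mulrA [to alpha g * _]mulrC to_alpha.
exists (alpha * v); split=> //.
apply: (fixed_subfield_adjoin to_aut) => //.
set F := gen_subfield _; have subF : is_subfield F := gen_subfield_is_subfield _.
have KF z : K z -> F z by move=> Kz; apply: sub_gen_subfield; left.
have Fv : F v.
  rewrite -[v](mulKf alpha0); apply: (subfieldM subF).
    by apply: KF; apply: (subfieldV subK).
  by apply: sub_gen_subfield; right.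
have FP : F (mon d (- n%:Z)).
  (* The relation for t^d identifies this monomial with the product of the generators of [K]. *)
  have -> : mon d (- n%:Z) = \prod_(i < n) (x i / s).
    by rewrite prodf_div -t_rel prodr_const card_ord exprnN.
  by apply: KF; apply: (subfield_prod subK).
have Fs : F s.
  (* The exponent of [t] is bd - db = 0, that of [s] is ad + nb = 1. *)
  have -> : s = v ^ d * mon d (- n%:Z) ^ (- b).
    rewrite !monX monM mulrNN [n%:Z * b]mulrC bezout mulrN [d * b]mulrC subrr.
    by rewrite /mon expr0z expr1z mul1r.
  by apply: (subfieldM subF); apply: (subfield_exprz subF).
have Ft : F t.
  (* The exponent of [t] is bn + da = 1, that of [s] is an - na = 0. *)
  have -> : t = v ^ n * mon d (- n%:Z) ^ a.
    rewrite !monX monM [d * a]mulrC [b * _ + _]addrC bezout mulNr.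
    by rewrite [n%:Z * a]mulrC subrr /mon expr0z expr1z mulr1.
  by apply: (subfieldM subF); apply: (subfield_exprz subF).
apply/seteqP; split=> //; rewrite -L_gen.
apply: gen_subfield_min => // y [[c _ <-]|[[->|->]|[i _ <-]]] //.
  exact: KF.
rewrite -[x i](divfK s0); apply: (subfieldM subF) => //; exact: KF.
Qed.
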